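(* There is a constant $c$ such that for every $\mathrm{LDL}_{cp}$ formula $\varphi$ over the propositions $P\cup\{p\}$ there is an alternating Büchi automaton $\mathfrak{A}_\varphi$ over the alphabet $2^{P\cup\{p\}}$ with at most $c\cdot|\varphi|$ states such that $L(\mathfrak{A}_\varphi)=\{w\in(2^{P\cup\{p\}})^\omega \mid w\models\varphi\}$.
   Context: Let $P$ be a finite set of atomic propositions and $p\notin P$ a fresh proposition; set $P'=P\cup\{p\}$. $\mathrm{LDL}_{cp}$ formulas and regular expressions over $P'$ are given by $\varphi ::= q \mid \neg q \mid \varphi\wedge\varphi \mid \varphi\vee\varphi \mid \langle r\rangle\varphi \mid [r]\varphi \mid \langle r\rangle_{cp}\varphi \mid [r]_{cp}\varphi$ and $r ::= \phi \mid \varphi? \mid r+r \mid r\,;r \mid r^*$, with $q\in P'$ and $\phi$ a propositional formula over $P'$. For $w=w_0w_1\cdots\in(2^{P'})^\omega$ and $n\in\mathbb{N}$: $(w,n)\models q$ iff $q\in w_n$, $\models\neg q$ iff $q\notin w_n$; $\wedge,\vee$ as usual; $(w,n)\models\langle r\rangle\psi$ iff there is $j$ with $(n,n+j)\in\mathcal{R}(r,w)$ and $(w,n+j)\models\psi$; $(w,n)\models[r]\psi$ iff for all $j$ with $(n,n+j)\in\mathcal{R}(r,w)$, $(w,n+j)\models\psi$. A position $m$ is a changepoint of $w$ if $m=0$ or the truth value of $p$ differs in $w_{m-1}$ and $w_m$. $(w,n)\models\langle r\rangle_{cp}\psi$ iff there is $j$ with $(n,n+j)\in\mathcal{R}(r,w)$,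 at most one of the positions $n,\dots,n+j-1$ is a changepoint, and $(w,n+j)\models\psi$; $(w,n)\models[r]_{cp}\psi$ iff for all $j$ with $(n,n+j)\in\mathcal{R}(r,w)$ and at most one changepoint among $n,\dots,n+j-1$, $(w,n+j)\models\psi$. Here $\mathcal{R}(\phi,w)=\{(n,n+1)\mid w_n\models\phi\}$, $\mathcal{R}(\psi?,w)=\{(n,n)\mid (w,n)\models\psi\}$, $\mathcal{R}(r_0+r_1)$ is the union, $\mathcal{R}(r_0;r_1)$ the relational composition, and $\mathcal{R}(r^* )$ the reflexive-transitive closure on $\mathbb{N}$ of $\mathcal{R}(r)$. $w\models\varphi$ means $(w,0)\models\varphi$. The size $|\varphi|$ is the number of subformulas of $\varphi$ (including formulas occurring in tests) plus the total length of the regular expressions occurring in $\varphi$ (with multiplicity). An alternating Büchi automaton $(Q,\Sigma,q_0,\delta,F)$ has transition function $\delta\colon Q\times\Sigma\to\mathcal{B}^+(Q)$ (positive Boolean combinations over $Q$, including true/false); a run on $w\in\Sigma^\omega$ is a DAG with vertices in $Q\times\mathbb{N}$ containing $(q_0,0)$, edges only from level $n$ to level $n+1$, and such that the set of successor states of each vertex $(q,n)$ satisfies $\delta(q,w_n)$; it is accepting if every infinite path visits $F$ infinitely often; $L(\mathfrak{A})$ is the set of words with an accepting run. *)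

(* Defs.v *)
From Stdlib Require Import Relation_Operators.
From HB Require Import structures.
From mathcomp Require Import all_boot.

Set Implicit Arguments.
Unset Strict Implicit.
Unset Printing Implicit Defensive.

(* The propositions P' = P u {p} are [option P]; the fresh p is [None]. *)
Notation prop_of P := (option P).
Notation letter P := {set prop_of P}.
Definition word (Sigma : Type) : Type := nat -> Sigma.

Section Syntax.
Variable P : finType.

Inductive pform : Type :=
  | PTrue
  | PFalse
  | PVar of prop_of P
  | PNot of pform
  | PAnd of pform & pform
  | POr of pform & pform.

Inductive formula : Type :=
  | FVar of prop_of P
  | FNVar of prop_of P
  | FAnd of formula & formula
  | FOr of formula & formula
  | FDia of regexp & formula
  | FBox of regexp & formula
  | FDiaCp of regexp & formula
  | FBoxCp of regexp & formula
with regexp : Type :=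
  | RGuard of pform
  | RTest of formula
  | RPlus of regexp & regexp
  | RSeq of regexp & regexp
  | RStar of regexp.

Lemma pform_comparable : comparable pform.
Proof.
have dec (q q' : prop_of P) : {q = q'} + {q <> q'} by exact (eq_comparable q q').
rewrite /comparable /decidable; decide equality.
Defined.

Fixpoint formula_comparable (f g : formula) : {f = g} + {f <> g}
with regexp_comparable (r s : regexp) : {r = s} + {r <> s}.
Proof.
- have dec (q q' : prop_of P) : {q = q'} + {q <> q'} by exact (eq_comparable q q').
  decide equality.
- have dec (h h' : pform) : {h = h'} + {h <> h'} by exact (pform_comparable h h').
  decide equality.
Defined.

HB.instance Definition _ := hasDecEq.Build formula (compareP formula_comparable).

(* Lists every occurrence; a literal [FNVar q] has no proper subformula. *)
Fixpoint subformulas (f : formula) : seq formula :=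
  f :: match f with
       | FVar _ | FNVar _ => [::]
       | FAnd g h | FOr g h => subformulas g ++ subformulas h
       | FDia r g | FBox r g | FDiaCp r g | FBoxCp r g =>
           test_subformulas r ++ subformulas g
       end
with test_subformulas (r : regexp) : seq formula :=
  match r with
  | RGuard _ => [::]
  | RTest g => subformulas g
  | RPlus r s | RSeq r s => test_subformulas r ++ test_subformulas s
  | RStar r => test_subformulas r
  end.

(* Guards and tests are the letters of a regular expression.  The formula in
   a test contributes separately, via [subformulas] and [tests_rlength]. *)
Fixpoint rlength (r : regexp) : nat :=
  match r with
  | RGuard _ | RTest _ => 1
  | RPlus r s | RSeq r s => (rlength r + rlength s).+1
  | RStar r => (rlength r).+1
  end.

(* Total length of the maximal regular expressions occurring in a formula, each
   occurrence being counted, together with those nested inside tests. *)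
Fixpoint total_rlength (f : formula) : nat :=
  match f with
  | FVar _ | FNVar _ => 0
  | FAnd g h | FOr g h => total_rlength g + total_rlength h
  | FDia r g | FBox r g | FDiaCp r g | FBoxCp r g =>
      rlength r + tests_rlength r + total_rlength g
  end
with tests_rlength (r : regexp) : nat :=
  match r with
  | RGuard _ => 0
  | RTest g => total_rlength g
  | RPlus r s | RSeq r s => tests_rlength r + tests_rlength s
  | RStar r => tests_rlength r
  end.

Definition fsize (f : formula) : nat :=
  size (undup (subformulas f)) + total_rlength f.

End Syntax.

Section Semantics.
Variable P : finType.
Implicit Types (w : word (letter P)) (n m j : nat).

Fixpoint peval (a : letter P) (g : pform P) : bool :=
  match g with
  | PTrue => true
  | PFalse => false
  | PVar q => q \in a
  | PNot g => ~~ peval a g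
  | PAnd g h => peval a g && peval a h
  | POr g h => peval a g || peval a h
  end.

Definition changepoint w m : bool :=
  (m == 0) || ((None \in w m.-1) != (None \in w m)).

Definition at_most_one_changepoint w n j : bool :=
  count (changepoint w) (iota n j) <= 1.

Fixpoint sat w n (f : formula P) : Prop :=
  match f with
  | FVar q => q \in w n
  | FNVar q => q \notin w n
  | FAnd g h => sat w n g /\ sat w n h
  | FOr g h => sat w n g \/ sat w n h
  | FDia r g => exists j, rmatch w r n (n + j) /\ sat w (n + j) g
  | FBox r g => forall j, rmatch w r n (n + j) -> sat w (n + j) g
  | FDiaCp r g =>
      exists j, [/\ rmatch w r n (n + j), at_most_one_changepoint w n j
                  & sat w (n + j) g]
  | FBoxCp r g =>
      forall j, rmatch w r n (n + j) -> at_most_one_changepoint w n j ->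
        sat w (n + j) g
  end
with rmatch w (r : regexp P) n m : Prop :=
  match r with
  | RGuard g => m = n.+1 /\ peval (w n) g
  | RTest g => m = n /\ sat w n g
  | RPlus r s => rmatch w r n m \/ rmatch w s n m
  | RSeq r s => exists2 k, rmatch w r n k & rmatch w s k m
  | RStar r => clos_refl_trans nat (rmatch w r) n m
  end.

Definition models w (f : formula P) : Prop := sat w 0 f.

End Semantics.

Section AlternatingBuchi.

Inductive posbool (Q : Type) : Type :=
  | BTrue
  | BFalse
  | BVar of Q
  | BAnd of posbool Q & posbool Q
  | BOr of posbool Q & posbool Q.

Fixpoint posbool_sat (Q : finType) (S : {set Q}) (b : posbool Q) : bool :=
  match b with
  | BTrue => true
  | BFalse => false
  | BVar q => q \in S
  | BAnd b c => posbool_sat S b && posbool_sat S c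
  | BOr b c => posbool_sat S b || posbool_sat S c
  end.

Record aba (Sigma : Type) : Type := ABA {
  state : finType;
  init : state;
  delta : state -> Sigma -> posbool state;
  final : {set state}
}.

Variables (Sigma : Type) (A : aba Sigma).

(* A levelled DAG: its vertices are the (q, n) with [q \in V n], and [E n q q']
   is the edge from (q, n) to (q', n.+1). *)
Definition is_run (w : word Sigma)
    (V : nat -> {set state A}) (E : nat -> rel (state A)) : Prop :=
  [/\ init A \in V 0,
      forall n q q', E n q q' -> q \in V n /\ q' \in V n.+1
    & forall n q, q \in V n ->
        posbool_sat [set q' | E n q q'] (delta q (w n))].

(* An infinite path may start at any level. *)
Definition accepting (E : nat -> rel (state A)) : Prop :=
  forall (m : nat) (rho : nat -> state A),
    (forall i, E (m + i) (rho i) (rho i.+1)) ->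
    forall k, exists2 i, k <= i & rho i \in final A.

Definition language (w : word Sigma) : Prop :=
  exists V E, is_run w V E /\ accepting E.

End AlternatingBuchi.

(* Main.v *)
Require Import Defs.
From mathcomp Require Import all_boot.
From Stdlib Require Import Relation_Operators Operators_Properties.
From HB Require Import structures.
From mathcomp Require Import boolp.

(* States are formulas together with a sign and a bounded memory: the initial
   formula and the modal formulas obtained from each occurrence of a modality
   by replacing its regular expression with one of the linearly many partial
   derivatives.  The transition function expands a formula at the current
   letter into a positive combination of such formulas at the next position.
   Along a path of a run the nesting depth never increases, so eventually only
   derivatives of modalities at one depth, all existential or all universal,
   are visited; universal states are accepting, so that a match promised by an
   existential state cannot be postponed forever.  The bound on changepoints
   costs one bit for the budget and the previous value of [p]. *)

Set Implicit Arguments.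
Unset Strict Implicit.
Unset Printing Implicit Defensive.

Scheme formula_mut := Induction for formula Sort Prop
  with regexp_mut := Induction for regexp Sort Prop.
Combined Scheme formula_regexp_ind from formula_mut, regexp_mut.

HB.instance Definition _ (P : finType) :=
  hasDecEq.Build (regexp P) (compareP (@regexp_comparable P)).

(** * Partial derivatives and the linear-size set of formulas serving as states *)

Section Derivatives.
Variable P : finType.
Implicit Types (f g : formula P) (r s : regexp P).

(** One shape for all four modalities, so that each argument is given once; [bx] selects boxes and
    [cp] the changepoint bound. *)
Definition modal (bx cp : bool) r g : formula P :=
  match bx, cp with
  | false, false => FDia r g
  | true, false => FBox r g
  | false, true => FDiaCp r g
  | true, true => FBoxCp r g
  end.

Lemma modalP f :
  (exists bx cp r g, f = modal bx cp r g)
  \/ (forall bx cp r g, f <> modal bx cp r g).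
Proof.
case: f => [q|q|g h|g h|r g|r g|r g|r g]; try by right=> -[] [].
- by left; exists false, false, r, g.
- by left; exists true, false, r, g.
- by left; exists false, true, r, g.
- by left; exists true, true, r, g.
Qed.

(** The empty word, expressed as the test of a tautology since the syntax has no constant for
    truth. *)
Definition eps : regexp P := RTest (FOr (FVar None) (FNVar None)).

(* What may remain of a regular expression once one of its guards has been
   consumed: Antimirov's partial derivatives, with respect to all letters. *)
Fixpoint derivs r : seq (regexp P) :=
  match r with
  | RGuard _ => [:: eps]
  | RTest _ => [::]
  | RPlus r s => derivs r ++ derivs s
  | RSeq r s => [seq RSeq r' s | r' <- derivs r] ++ derivs s
  | RStar r => [seq RSeq r' (RStar r) | r' <- derivs r]
  end.

(** These are the formulas whose value at the next position can matter for [f] now. A modality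
    contributes its derivatives and not itself, so the initial formula is added separately later. *)
Fixpoint atoms f : seq (formula P) :=
  match f with
  | FVar _ | FNVar _ => [::]
  | FAnd g h | FOr g h => atoms g ++ atoms h
  | FDia r g => [seq FDia r' g | r' <- derivs r] ++ (test_atoms r ++ atoms g)
  | FBox r g => [seq FBox r' g | r' <- derivs r] ++ (test_atoms r ++ atoms g)
  | FDiaCp r g =>
      [seq FDiaCp r' g | r' <- derivs r] ++ (test_atoms r ++ atoms g)
  | FBoxCp r g =>
      [seq FBoxCp r' g | r' <- derivs r] ++ (test_atoms r ++ atoms g)
  end
with test_atoms r : seq (formula P) :=
  match r with
  | RGuard _ => [::]
  | RTest g => atoms g
  | RPlus r s | RSeq r s => test_atoms r ++ test_atoms s
  | RStar r => test_atoms r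
  end.

(* A guard has depth 1 so that it is not exceeded by its derivative [eps]. *)
Fixpoint depth f : nat :=
  match f with
  | FVar _ | FNVar _ => 0
  | FAnd g h | FOr g h => (maxn (depth g) (depth h)).+1
  | FDia r g | FBox r g | FDiaCp r g | FBoxCp r g =>
      (maxn (rdepth r) (depth g)).+1
  end
with rdepth r : nat :=
  match r with
  | RGuard _ => 1
  | RTest g => depth g
  | RPlus r s | RSeq r s => maxn (rdepth r) (rdepth s)
  | RStar r => rdepth r
  end.

Lemma atoms_modal bx cp r g :
  atoms (modal bx cp r g)
  = [seq modal bx cp r' g | r' <- derivs r] ++ (test_atoms r ++ atoms g).
Proof. by case: bx cp => [] []. Qed.

Lemma derivs_atoms bx cp r r' g : r' \in derivs r ->
  modal bx cp r' g \in atoms (modal bx cp r g).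
Proof.
by move=> r'in; rewrite atoms_modal mem_cat; apply/orP; left; apply/mapP;
  exists r'.
Qed.

Lemma depth_modal bx cp r g :
  depth (modal bx cp r g) = (maxn (rdepth r) (depth g)).+1.
Proof. by case: bx cp => [] []. Qed.

Lemma rdepth_derivs r r' : r' \in derivs r -> rdepth r' <= rdepth r.
Proof.
elim: r r' => [q|f|r IHr s IHs|r IHr s IHs|r IHr] r' //=.
- by rewrite inE => /eqP->.
- by rewrite mem_cat leq_max => /orP[/IHr->|/IHs->]; rewrite ?orbT.
- rewrite mem_cat => /orP[/mapP[r1 /IHr le ->]|/IHs le] /=.
    by rewrite geq_max leq_maxr leq_max le.
  by rewrite leq_max le orbT.
- by case/mapP=> r1 /IHr le -> /=; rewrite geq_max le leqnn.
Qed.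

Lemma depth_atoms :
  (forall f x, x \in atoms f -> depth x <= depth f) /\
  (forall r x, x \in test_atoms r -> depth x <= rdepth r).
Proof.
suff mod bx cp r g :
    (forall x, x \in test_atoms r -> depth x <= rdepth r) ->
    (forall x, x \in atoms g -> depth x <= depth g) ->
    forall x, x \in atoms (modal bx cp r g) ->
      depth x <= depth (modal bx cp r g).
  apply: (@formula_regexp_ind P) => //=.
  - move=> g IHg h IHh x; rewrite mem_cat => /orP[/IHg|/IHh] le;
      by rewrite leqW // leq_max le ?orbT.
  - move=> g IHg h IHh x; rewrite mem_cat => /orP[/IHg|/IHh] le;
      by rewrite leqW // leq_max le ?orbT.
  - by move=> r IHr g; exact: (mod false false).
  - by move=> r IHr g; exact: (mod true false).
  - by move=> r IHr g; exact: (mod false true).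
  - by move=> r IHr g; exact: (mod true true).
  - move=> r IHr s IHs x; rewrite mem_cat => /orP[/IHr|/IHs] le;
      by rewrite leq_max le ?orbT.
  - move=> r IHr s IHs x; rewrite mem_cat => /orP[/IHr|/IHs] le;
      by rewrite leq_max le ?orbT.
move=> IHr IHg x; rewrite atoms_modal depth_modal !mem_cat.
case/or3P=> [/mapP[r' /rdepth_derivs le ->]|/IHr le|/IHg le].
- by rewrite depth_modal ltnS geq_max leq_maxr leq_max le.
- by rewrite leqW // leq_max le.
- by rewrite leqW // leq_max le orbT.
Qed.

(** This makes depth a rank for the automaton: a path that stays at one depth stays within
    derivatives of a single modality with a fixed body. *)
Lemma atomsP f x : x \in atoms f ->
  depth x < depth f \/
  exists bx cp r r' g, f = modal bx cp r g /\ x = modal bx cp r' g.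
Proof.
have [dA dT] := depth_atoms.
case: f => [q|q|g h|g h|r g|r g|r g|r g] //=; rewrite !mem_cat;
  try by case/orP=> /dA le; left; rewrite ltnS leq_max le ?orbT.
all: case/or3P=> [/mapP[r' _ ->]|/dT le|/dA le];
  try by left; rewrite ltnS leq_max le ?orbT.
- by right; exists false, false, r, r', g.
- by right; exists true, false, r, r', g.
- by right; exists false, true, r, r', g.
- by right; exists true, true, r, r', g.
Qed.

Lemma derivs_trans r r' : r' \in derivs r -> {subset derivs r' <= derivs r}.
Proof.
elim: r r' => [q|f|r IHr s IHs|r IHr s IHs|r IHr] r' //=.
- by rewrite inE => /eqP->.
- by rewrite mem_cat => /orP[/IHr|/IHs] sub x /sub; rewrite mem_cat => ->;
    rewrite ?orbT.
- rewrite mem_cat => /orP[/mapP[r1 /IHr sub ->]|/IHs sub] x /=.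
    rewrite !mem_cat => /orP[/mapP[r2 /sub r2in ->]|->]; last by rewrite orbT.
    by rewrite map_f.
  by move/sub; rewrite mem_cat => ->; rewrite orbT.
- case/mapP=> r1 /IHr sub -> x /=.
  by rewrite mem_cat => /orP[/mapP[r2 /sub r2in ->]|//]; rewrite map_f.
Qed.

Lemma test_atoms_derivs r r' :
  r' \in derivs r -> {subset test_atoms r' <= test_atoms r}.
Proof.
elim: r r' => [q|f|r IHr s IHs|r IHr s IHs|r IHr] r' //=.
- by rewrite inE => /eqP->.
- by rewrite mem_cat => /orP[/IHr|/IHs] sub x /sub; rewrite mem_cat => ->;
    rewrite ?orbT.
- rewrite mem_cat => /orP[/mapP[r1 /IHr sub ->]|/IHs sub] x /=.
    by rewrite !mem_cat => /orP[/sub->|->]; rewrite ?orbT.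
  by move/sub; rewrite mem_cat => ->; rewrite orbT.
- case/mapP=> r1 /IHr sub -> x /=.
  by rewrite mem_cat => /orP[/sub|].
Qed.

(** Derivatives of derivatives are already derivatives, so transitions never leave the state set. *)
Lemma atoms_trans f x : x \in atoms f -> {subset atoms x <= atoms f}.
Proof.
suff [H _] : (forall f x, x \in atoms f -> {subset atoms x <= atoms f}) /\
  (forall r x, x \in test_atoms r -> {subset atoms x <= test_atoms r}).
  exact: H.
have cat2 (T : eqType) (A : T -> seq T) (s t : seq T) :
    (forall y, y \in s -> {subset A y <= s}) ->
    (forall y, y \in t -> {subset A y <= t}) ->
    forall y, y \in s ++ t -> {subset A y <= s ++ t}.
  by move=> Hs Ht y; rewrite mem_cat => /orP[/Hs|/Ht] sub z /sub;
    rewrite mem_cat => ->; rewrite ?orbT.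
suff mod bx cp r g :
    (forall y, y \in test_atoms r -> {subset atoms y <= test_atoms r}) ->
    (forall y, y \in atoms g -> {subset atoms y <= atoms g}) ->
    forall y, y \in atoms (modal bx cp r g) ->
      {subset atoms y <= atoms (modal bx cp r g)}.
  apply: (@formula_regexp_ind P) => //=; try by move=> *; exact: cat2.
  - by move=> r IHr g; exact: (mod false false).
  - by move=> r IHr g; exact: (mod true false).
  - by move=> r IHr g; exact: (mod false true).
  - by move=> r IHr g; exact: (mod true true).
move=> IHr IHg y; rewrite {1}atoms_modal mem_cat => /orP[|yin].
  case/mapP=> r' r'in -> z; rewrite {1}atoms_modal !mem_cat.
  case/or3P=> [/mapP[r2 /(derivs_trans r'in) r2in ->]|zin|zin].
  - exact: derivs_atoms.
  - by rewrite atoms_modal !mem_cat (test_atoms_derivs r'in zin) orbT.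
  - by rewrite atoms_modal !mem_cat zin !orbT.
by move=> z /(cat2 _ _ _ _ IHr IHg y yin) zin; rewrite atoms_modal mem_cat zin orbT.
Qed.

Lemma size_derivs r : size (derivs r) <= rlength r.
Proof.
elim: r => [q|f|r IHr s IHs|r IHr s IHs|r IHr] //=;
  rewrite ?size_cat ?size_map ?leqW //; by rewrite leq_add.
Qed.

Lemma size_atoms f : size (atoms f) <= total_rlength f.
Proof.
suff [H _] : (forall f, size (atoms f) <= total_rlength f) /\
  (forall r, size (test_atoms r) <= tests_rlength r) by exact: H.
by apply: (@formula_regexp_ind P) => //= *;
  rewrite ?size_cat ?size_map -?addnA ?leq_add ?size_derivs.
Qed.

End Derivatives.

Arguments modal {P} bx cp r g : simpl never.

(** * One-step expansion of a formula at a letter, and its monotonicity *)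

Section Expansion.
Variables (P : finType) (a : letter P) (ch : bool).
Implicit Types (f g : formula P) (r s : regexp P).

(* [S b c x] tells whether, at the next position, the formula [x] has truth
   value [b]; the flag [c] records that the only changepoint allowed by an
   outermost cp-modality has already been used up. *)
Definition valuation := bool -> bool -> formula P -> bool.
Implicit Types (S : valuation).

(** Under a negation, asserting the value [b] becomes refusing to assert the opposite value. *)
Definition dual S : valuation := fun b c x => ~~ S (~~ b) c x.

Lemma dualK S : dual (dual S) = S.
Proof.
by apply/funext => b; apply/funext => c; apply/funext => x;
  rewrite /dual !negbK.
Qed.

(** The first conjunct blocks a cp-match that would pass a second changepoint. The xor with [bx]
    asks for the negated box, since boxes are expanded as negated diamonds. *)
Definition step S (c bx cp : bool) g r : bool :=
  ~~ [&& cp, c & ch] && (bx (+) S true (cp && (c || ch)) (modal bx cp r g)).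

(* [ev S c f] expresses [f] at the current position, which carries the letter
   [a], by the values [S] at the next one.  In [exp S r st K], the value of
   [st r'] stands for the remainder [r'] at the next position and [K] for a
   match ending here; [K || exp r _ false] is the least fixpoint for the star,
   as a round without guards is useless.  Boxes are negated diamonds; the dual
   valuation keeps everything monotone in [S]. *)
Fixpoint ev S (c : bool) f : bool :=
  match f with
  | FVar q => q \in a
  | FNVar q => q \notin a
  | FAnd g h => ev S false g && ev S false h
  | FOr g h => ev S false g || ev S false h
  | FDia r g => exp S r (step S c false false g) (ev S false g)
  | FBox r g => ~~ exp (dual S) r (step S c true false g) (~~ ev S false g)
  | FDiaCp r g => exp S r (step S c false true g) (ev S false g)
  | FBoxCp r g => ~~ exp (dual S) r (step S c true true g) (~~ ev S false g)
  end
with exp S r (st : regexp P -> bool) (K : bool) : bool :=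
  match r with
  | RGuard q => peval a q && st (eps P)
  | RTest g => ev S false g && K
  | RPlus r s => exp S r st K || exp S s st K
  | RSeq r s => exp S r (fun r' => st (RSeq r' s)) (exp S s st K)
  | RStar r => K || exp S r (fun r' => st (RSeq r' (RStar r))) false
  end.

Definition evs (b : bool) S c f : bool :=
  if b then ev S c f else ~~ ev (dual S) c f.

Lemma evs_dual b S c f : evs (~~ b) (dual S) c f = ~~ evs b S c f.
Proof. by case: b; rewrite /evs /= ?dualK ?negbK. Qed.

Lemma ev_modal S c bx cp r g :
  ev S c (modal bx cp r g)
  = bx (+) exp (if bx then dual S else S) r (step S c bx cp g)
             (bx (+) ev S false g).
Proof. by case: bx cp => [] []. Qed.

(** A true diamond and a false box both claim that a match exists, so with this sign the two expand
    alike. *)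
Lemma evs_modal S c bx cp r g :
  evs (~~ bx) S c (modal bx cp r g)
  = exp S r (fun r' => ~~ [&& cp, c & ch]
               && S (~~ bx) (cp && (c || ch)) (modal bx cp r' g))
      (evs (~~ bx) S false g).
Proof.
rewrite /evs; case: bx => /=; rewrite ev_modal /=; last by [].
rewrite dualK negbK; congr (exp _ _ _ _).
by apply/funext => r'; rewrite /step /dual /= negbK.
Qed.

(** For a box, the outer negation and the passage to the dual each reverse the order, and the two
    reversals cancel. Comparing only on atoms also shows that no other values are read. *)
Lemma ev_exp_mono :
  (forall f c S1 S2,
     (forall b c x, x \in atoms f -> S1 b c x -> S2 b c x) ->
     ev S1 c f -> ev S2 c f) /\
  (forall r S1 S2 (st1 st2 : regexp P -> bool) (K1 K2 : bool),
     (forall b c x, x \in test_atoms r -> S1 b c x -> S2 b c x) ->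
     (forall r', r' \in derivs r -> st1 r' -> st2 r') -> (K1 -> K2) ->
     exp S1 r st1 K1 -> exp S2 r st2 K2).
Proof.
suff mod bx cp r g :
   (forall S1 S2 (st1 st2 : regexp P -> bool) (K1 K2 : bool),
     (forall b c x, x \in test_atoms r -> S1 b c x -> S2 b c x) ->
     (forall r', r' \in derivs r -> st1 r' -> st2 r') -> (K1 -> K2) ->
     exp S1 r st1 K1 -> exp S2 r st2 K2) ->
   (forall c S1 S2, (forall b c x, x \in atoms g -> S1 b c x -> S2 b c x) ->
     ev S1 c g -> ev S2 c g) ->
   forall c S1 S2,
     (forall b c x, x \in atoms (modal bx cp r g) -> S1 b c x -> S2 b c x) ->
     ev S1 c (modal bx cp r g) -> ev S2 c (modal bx cp r g).
  apply: (@formula_regexp_ind P) => //=.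
  - move=> g IHg h IHh c S1 S2 sub /andP[gS hS]; apply/andP; split.
      by apply: IHg gS => b e x xin; apply: sub; rewrite mem_cat xin.
    by apply: IHh hS => b e x xin; apply: sub; rewrite mem_cat xin orbT.
  - move=> g IHg h IHh c S1 S2 sub /orP[gS|hS]; apply/orP; [left|right].
      by apply: IHg gS => b e x xin; apply: sub; rewrite mem_cat xin.
    by apply: IHh hS => b e x xin; apply: sub; rewrite mem_cat xin orbT.
  - by move=> r IHr g; exact: (mod false false).
  - by move=> r IHr g; exact: (mod true false).
  - by move=> r IHr g; exact: (mod false true).
  - by move=> r IHr g; exact: (mod true true).
  - move=> q S1 S2 st1 st2 K1 K2 _ sub _ /andP[-> /=].
    by apply: sub; rewrite inE.
  - move=> g IHg S1 S2 st1 st2 K1 K2 sub _ subK /andP[gS /subK->].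
    by rewrite andbT; apply: IHg gS.
  - move=> r IHr s IHs S1 S2 st1 st2 K1 K2 sub subst subK.
    case/orP=> [rS|sS]; apply/orP; [left|right].
    + apply: IHr rS => // [b c x xin|r' xin].
        by apply: sub; rewrite mem_cat xin.
      by apply: subst; rewrite mem_cat xin.
    + apply: IHs sS => // [b c x xin|r' xin].
        by apply: sub; rewrite mem_cat xin orbT.
      by apply: subst; rewrite mem_cat xin orbT.
  - move=> r IHr s IHs S1 S2 st1 st2 K1 K2 sub subst subK.
    apply: IHr => [b c x xin|r' r'in|].
    + by apply: sub; rewrite mem_cat xin.
    + by apply: subst; rewrite mem_cat map_f.
    + apply: IHs => // [b c x xin|r' r'in].
        by apply: sub; rewrite mem_cat xin orbT.
      by apply: subst; rewrite mem_cat r'in orbT.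
  - move=> r IHr S1 S2 st1 st2 K1 K2 sub subst subK.
    case/orP=> [/subK->//|H]; apply/orP; right; move: H.
    by apply: IHr => // r' r'in; apply: subst; rewrite map_f.
move=> IHr IHg c S1 S2 sub.
have subd b e x : x \in atoms (modal bx cp r g) ->
    dual S2 b e x -> dual S1 b e x.
  by move=> xin; rewrite /dual; apply: contra; exact: sub.
have evg : ev S1 false g -> ev S2 false g.
  by apply: IHg => b e x xin; apply: sub; rewrite atoms_modal !mem_cat xin !orbT.
have tin x : x \in test_atoms r -> x \in atoms (modal bx cp r g).
  by move=> xin; rewrite atoms_modal !mem_cat xin orbT.
have rin r' : r' \in derivs r -> modal bx cp r' g \in atoms (modal bx cp r g).
  exact: derivs_atoms.
rewrite !ev_modal; case: bx sub subd tin rin => /= sub subd tin rin.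
  apply: contra; apply: IHr.
  - by move=> b e x /tin; exact: subd.
  - move=> r' /rin xin; rewrite /step => /andP[->] /=.
    by apply: contra; exact: sub.
  - by apply: contra.
apply: IHr => //.
- by move=> b e x /tin; exact: sub.
- by move=> r' /rin xin; rewrite /step => /andP[->] /=; exact: sub.
Qed.

Lemma evs_mono b c f S1 S2 :
  (forall b c x, x \in atoms f -> S1 b c x -> S2 b c x) ->
  evs b S1 c f -> evs b S2 c f.
Proof.
have [mono _] := ev_exp_mono.
move=> sub; case: b; first exact: mono.
apply: contra; apply: mono => b e x xin; rewrite /dual.
by apply: contra; exact: sub.
Qed.

(** At undiminished depth an existential expansion consults only derivatives of the same modality
    with the same sign. The universal sign is later handled through the dual valuation. *)
Lemma evs_modal_mono bx cp c r g S1 S2 :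
  (forall b c x, x \in atoms (modal bx cp r g) ->
     depth x < depth (modal bx cp r g) -> S1 b c x -> S2 b c x) ->
  (forall c r', modal bx cp r' g \in atoms (modal bx cp r g) ->
     S1 (~~ bx) c (modal bx cp r' g) -> S2 (~~ bx) c (modal bx cp r' g)) ->
  evs (~~ bx) S1 c (modal bx cp r g) -> evs (~~ bx) S2 c (modal bx cp r g).
Proof.
have [dA dT] := @depth_atoms P.
move=> sub subm; rewrite !evs_modal; apply: ev_exp_mono.2.
- move=> b e x xin; apply: sub; rewrite ?atoms_modal ?mem_cat ?xin ?orbT //.
  by rewrite depth_modal ltnS leq_max dT.
- move=> r' xin /andP[-> /subm->] //.
  exact: derivs_atoms.
- apply: evs_mono => b e x xin; apply: sub.
    by rewrite atoms_modal !mem_cat xin !orbT.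
  by rewrite depth_modal ltnS leq_max (dA _ _ xin) orbT.
Qed.

End Expansion.

(** * Correctness of the expansion with respect to the semantics *)

Section Truth.
Variables (P : finType) (w : word (letter P)).
Implicit Types (f g : formula P) (r s : regexp P) (S : valuation P).

Lemma rmatch_le r n m : rmatch w r n m -> n <= m.
Proof.
elim: r n m => [q|f|r IHr s IHs|r IHr s IHs|r IHr] n m /=.
- by case=> ->.
- by case=> ->.
- by case=> [/IHr|/IHs].
- by case=> k /IHr nk /IHs; apply: leq_trans.
- elim=> [x y /IHr//|//|x y z _ xy _]; exact: leq_trans.
Qed.

(** Rounds that consume no letter can be skipped, so the first round may be assumed to advance. *)
Lemma rmatch_star r n m :
  rmatch w (RStar r) n m <->
  m = n \/ exists k, [/\ rmatch w r n k, n < k & rmatch w (RStar r) k m].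
Proof.
split=> /= [H|[->|[k [nk _ km]]]].
- elim: (clos_rt_rt1n _ _ _ _ H) => [x|x y z xy yz IH]; first by left.
  have := rmatch_le xy; rewrite leq_eqVlt => /orP[/eqP e|lt].
    by move: IH; rewrite e.
  right; exists y; split=> //; exact: clos_rt1n_rt.
- exact: rt_refl.
- by apply: rt_trans km; apply: rt_step.
Qed.

Lemma rmatch_eps n m : rmatch w (eps P) n m <-> m = n.
Proof.
split=> [[]//|->]; split=> //=.
by case: (_ \in _); [left|right].
Qed.

(* The number of changepoints in [n, m) that [truth] allows is [~~ c], as [c]
   says that the changepoint allowed by a cp-modality has been used up. *)
Definition reach n (c bx cp : bool) g m : Prop :=
  (cp ==> (count (changepoint w) (iota n (m - n)) <= ~~ c))
  && (bx (+) `[< sat w m g >]).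

(** For a box this is a counterexample: an admissible match whose end violates [g]. *)
Definition wit n c (bx cp : bool) r g m : Prop :=
  rmatch w r n m /\ reach n c bx cp g m.

Definition fwit n c f m : Prop :=
  match f with
  | FDia r g => wit n c false false r g m
  | FBox r g => wit n c true false r g m
  | FDiaCp r g => wit n c false true r g m
  | FBoxCp r g => wit n c true true r g m
  | _ => False
  end.

Definition truth n c f : bool :=
  match f with
  | FDia _ _ | FDiaCp _ _ => `[< exists m, fwit n c f m >]
  | FBox _ _ | FBoxCp _ _ => ~~ `[< exists m, fwit n c f m >]
  | _ => `[< sat w n f >]
  end.

Lemma fwit_modal n c bx cp r g : fwit n c (modal bx cp r g) = wit n c bx cp r g.
Proof. by case: bx cp => [] []. Qed.

Lemma truth_modal n c bx cp r g :
  truth n c (modal bx cp r g) = bx (+) `[< exists m, wit n c bx cp r g m >].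
Proof. by case: bx cp => [] []. Qed.

Lemma truth_sat n f : truth n false f = `[< sat w n f >].
Proof.
have sub n' m : n' + m - n' = m by rewrite addnC addnK.
have le n' m r : rmatch w r n' m -> exists j, m = n' + j.
  by move/rmatch_le => le; exists (m - n'); rewrite subnKC.
case: f => //= r g; rewrite -?asbool_neg; apply: asbool_equiv_eq.
- split=> [[m [rm]]|[j [rm gj]]].
    by case: (le _ _ _ rm) => j e; rewrite e in rm * => /asboolP ?; exists j.
  by exists (n + j); split=> //; apply/asboolP.
- split=> [H j rm|H [m [rm]]].
    apply: contrapT => ng; apply: H; exists (n + j); split=> //.
    by apply/negP; move/asboolP.
  by case: (le _ _ _ rm) => j e; rewrite e in rm * => /negP[]; apply/asboolP/H.
- split=> [[m [rm]]|[j [rm cj gj]]].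
    case: (le _ _ _ rm) => j e; rewrite e in rm *.
    by rewrite /reach sub => /andP[cj /asboolP gj]; exists j.
  by exists (n + j); split=> //; rewrite /reach sub; apply/andP; split=> //;
    apply/asboolP.
- split=> [H j rm cj|H [m [rm]]].
    apply: contrapT => ng; apply: H; exists (n + j); split=> //.
    rewrite /reach sub; apply/andP; split=> //=.
    by apply/negP; move/asboolP.
  case: (le _ _ _ rm) => j e; rewrite e in rm *.
  by rewrite /reach sub => /andP[cj /negP[]]; apply/asboolP/H.
Qed.

Lemma reach_now n c bx cp g :
  reach n c bx cp g n <-> bx (+) truth n false g.
Proof. by rewrite truth_sat /reach subnn implybT. Qed.

Lemma reach_step n c bx cp g m : n < m ->
  reach n c bx cp g m <->
  ~~ [&& cp, c & changepoint w n]
  && `[< reach n.+1 (cp && (c || changepoint w n)) bx cp g m >].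
Proof.
move=> lt; rewrite /reach; case: cp => /=; last by rewrite asboolb.
have -> : m - n = (m - n.+1).+1 by rewrite -subSn // subSS.
rewrite asboolb andbA /=; set k := count _ _.
by case: c (changepoint w n) => [] [].
Qed.

Definition true_at n : valuation P := fun b c x => truth n c x == b.

(** Exactly one sign is correct for each formula, so genuine truth is self-dual. *)
Lemma dual_true n : dual (true_at n) = true_at n.
Proof.
apply/funext => b; apply/funext => c; apply/funext => x.
by rewrite /dual /true_at; case: b (truth n c x) => [] [].
Qed.

Section Position.
Variable n : nat.

Local Notation ev_ := (ev (w n) (changepoint w n)).
Local Notation exp_ := (exp (w n) (changepoint w n)).
Local Notation evs_ := (evs (w n) (changepoint w n)).

(* The acceptance property [Q] is a parameter so that in a sequence the
   second factor can be absorbed into it. *)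
Lemma ev_exp_true :
  (forall f c, ev_ (true_at n.+1) c f = truth n c f) /\
  (forall r (Q : nat -> Prop) (st : regexp P -> bool) (K : bool),
     (forall r', st r' <-> exists2 m, rmatch w r' n.+1 m & Q m) ->
     (K <-> Q n) ->
     exp_ (true_at n.+1) r st K <-> exists2 m, rmatch w r n m & Q m).
Proof.
suff mod bx cp r g :
  (forall (Q : nat -> Prop) (st : regexp P -> bool) (K : bool),
     (forall r', st r' <-> exists2 m, rmatch w r' n.+1 m & Q m) ->
     (K <-> Q n) ->
     exp_ (true_at n.+1) r st K <-> exists2 m, rmatch w r n m & Q m) ->
  (forall c, ev_ (true_at n.+1) c g = truth n c g) ->
  forall c, ev_ (true_at n.+1) c (modal bx cp r g) = truth n c (modal bx cp r g).
  apply: (@formula_regexp_ind P)=> //=.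
  - by move=> q _; rewrite asboolb.
  - by move=> q _; rewrite asboolb.
  - by move=> g IHg h IHh _; rewrite IHg IHh !truth_sat asbool_and.
  - by move=> g IHg h IHh _; rewrite IHg IHh !truth_sat asbool_or.
  - by move=> r IHr g; exact: (mod false false).
  - by move=> r IHr g; exact: (mod true false).
  - by move=> r IHr g; exact: (mod false true).
  - by move=> r IHr g; exact: (mod true true).
  - move=> q Q st K Hst _; split=> [/andP[qn /Hst[m /rmatch_eps-> Qm]]|].
      by exists n.+1.
    case=> m [-> qn] Qm; apply/andP; split=> //.
    by apply/Hst; exists n.+1 => //; apply/rmatch_eps.
  - move=> g IHg Q st K _ HK; rewrite IHg truth_sat.
    split=> [/andP[/asboolP gn /HK Qn]|[m [-> gn] Qn]]; first by exists n.
    by apply/andP; split; [apply/asboolP|apply/HK].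
  - move=> r IHr s IHs Q st K Hst HK.
    have {}IHr := IHr Q st K Hst HK; have {}IHs := IHs Q st K Hst HK.
    split=> [/orP[/IHr|/IHs] [m]|[m [rm|sm] Qm]].
    + by exists m => //; left.
    + by exists m => //; right.
    + by apply/orP; left; apply/IHr; exists m.
    + by apply/orP; right; apply/IHs; exists m.
  - move=> r IHr s IHs Q st K Hst HK.
    have -> := IHr (fun k => exists2 m, rmatch w s k m & Q m).
    + by split=> [[k rk [m sm Qm]]|[m [k rk sm] Qm]];
        [exists m => //; exists k | exists k => //; exists m].
    + move=> r'; rewrite Hst.
      by split=> [[m [k rk sm] Qm]|[k rk [m sm Qm]]];
        [exists k => //; exists m | exists m => //; exists k].
    + exact: IHs.
  - move=> r IHr Q st K Hst HK.
    (* The condition [n < k] fails at [n] itself, which fits the value [false] given to a round that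
       ends without consuming a letter. *)
    have {}IHr : exp_ (true_at n.+1) r (fun r' => st (RSeq r' (RStar r))) false
        <-> exists2 k, rmatch w r n k
              & n < k /\ exists2 m, rmatch w (RStar r) k m & Q m.
      apply: IHr => [r'|]; last by split=> // -[]; rewrite ltnn.
      rewrite Hst; split=> [[m [k rk km] Qm]|[k rk [_ [m km Qm]]]].
        by exists k => //; split; [exact: rmatch_le rk|exists m].
      by exists m => //; exists k.
    split=> [/orP[/HK Qn|/IHr[k rk [lt [m km Qm]]]]|].
    + by exists n => //; apply/rmatch_star; left.
    + by exists m => //; apply/rmatch_star; right; exists k.
    + case=> m /rmatch_star[->|[k [rk lt km]]] Qm; apply/orP.
        by left; apply/HK.
      by right; apply/IHr; exists k => //; split=> //; exists m.
move=> IHr IHg c; rewrite ev_modal dual_true if_same truth_modal.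
have E := IHr (reach n c bx cp g)
  (step (changepoint w n) (true_at n.+1) c bx cp g) (bx (+) truth n false g).
rewrite IHg; have {}E : exp_ (true_at n.+1) r
    (step (changepoint w n) (true_at n.+1) c bx cp g) (bx (+) truth n false g)
    <-> exists2 m, rmatch w r n m & reach n c bx cp g m.
  apply: E => [r'|]; last by rewrite reach_now.
  split=> [/andP[ok]|[m rm]].
    rewrite /true_at truth_modal eqb_id addbA addbb => /asboolP[m [rm Qm]].
    exists m => //; apply/(reach_step _ _ _ _ (rmatch_le rm)); rewrite ok.
    exact/asboolP.
  move/(reach_step _ _ _ _ (rmatch_le rm))/andP=> [ok /asboolP Qm].
  rewrite /step ok /true_at truth_modal eqb_id addbA addbb.
  by apply/asboolP; exists m.
congr (_ (+) _).
by apply/idP/asboolP => [/E[m rm Qm]|[m [rm Qm]]]; [exists m|apply/E; exists m].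
Qed.

Lemma evs_true b c f : evs_ b (true_at n.+1) c f = (truth n c f == b).
Proof.
have [T _] := ev_exp_true.
rewrite /evs dual_true T; case: b => //.
Qed.

(** To satisfy an existential expansion it suffices to follow one fixed match end [m]: a derivative
    has to be granted only if [m] is still a witness for it. *)
Lemma evs_wit S c bx cp r g m :
  (forall b c' x, x \in atoms (modal bx cp r g) ->
     depth x < depth (modal bx cp r g) -> truth n.+1 c' x == b -> S b c' x) ->
  (forall c' r', modal bx cp r' g \in atoms (modal bx cp r g) ->
     wit n.+1 c' bx cp r' g m -> S (~~ bx) c' (modal bx cp r' g)) ->
  wit n c bx cp r g m -> evs_ (~~ bx) S c (modal bx cp r g).
Proof.
move=> sub subm [rm gm]; rewrite evs_modal.
have [dA dT] := depth_atoms P.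
(* Acceptance is pinned to [m], so that the expansion cannot be satisfied through another match. *)
pose Q k := k = m /\ reach n c bx cp g k.
have H : exp_ (true_at n.+1) r
    (fun r' => `[< exists2 k, rmatch w r' n.+1 k & Q k >]) `[< Q n >].
  by apply/(ev_exp_true.2 r Q) => [r'||]; [split=> /asboolP|split=> /asboolP|exists m].
move: H; apply: (ev_exp_mono _ _).2 => [b e x xin|r' r'in /asboolP[k r'm [e _]]|].
- apply: sub; rewrite ?atoms_modal ?mem_cat ?xin ?orbT //.
  by rewrite depth_modal ltnS leq_max dT.
- rewrite {}e in r'm.
  move/(reach_step _ _ _ _ (rmatch_le r'm)): gm => /andP[-> /asboolP gm].
  by apply: subm; [exact: derivs_atoms|].
- case/asboolP=> _ /reach_now gn.
  suff: evs_ (~~ bx) (true_at n.+1) false g.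
    apply: evs_mono => b e x xin; apply: sub.
      by rewrite atoms_modal !mem_cat xin !orbT.
    by rewrite depth_modal ltnS leq_max (dA _ _ xin) orbT.
  by rewrite evs_true; case: (bx) gn; case: (truth _ _ _).
Qed.

End Position.

Lemma truth_wit n c bx cp r g :
  reflect (exists m, wit n c bx cp r g m) (truth n c (modal bx cp r g) == ~~ bx).
Proof.
rewrite truth_modal; apply: (iffP eqP) => [|H].
  by case: asboolP => // _; case: (bx).
by rewrite asboolT //; case: (bx).
Qed.

End Truth.

(** * Construction of the alternating automaton *)

Section Automaton.
Variables (P : finType) (phi : formula P).

Section PositiveFormula.
Variable Q : finType.
Implicit Types (X Y : {set Q}) (F : {set Q} -> bool).

(** Disjunctive normal form of a monotone set predicate. It may be exponentially long, but only
    states are counted. *)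
Definition posbool_of F : posbool Q :=
  \big[@BOr Q/@BFalse Q]_(X : {set Q} | F X)
     \big[@BAnd Q/@BTrue Q]_(x in X) BVar x.

Lemma posbool_ofP F X :
  (forall X Y, X \subset Y -> F X -> F Y) -> posbool_sat X (posbool_of F) = F X.
Proof.
move=> mono.
rewrite /posbool_of (big_morph (posbool_sat X) (id1 := false) (op1 := orb)) //.
rewrite big_has_cond; apply/hasP/idP => [[Y _ /andP[FY]]|FX].
  rewrite (big_morph (posbool_sat X) (id1 := true) (op1 := andb)) //= big_all_cond.
  move=> /allP sub; apply: mono FY; apply/subsetP => y yY.
  by have /implyP := sub y (mem_index_enum y); apply.
exists X; first exact: mem_index_enum.
rewrite /= FX (big_morph (posbool_sat X) (id1 := true) (op1 := andb)) //= big_all_cond.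
by apply/allP => y _; apply/implyP.
Qed.

End PositiveFormula.

Implicit Types (w : word (letter P)) (f g x : formula P) (r : regexp P).

(* A state holds the truth value of [p] at the preceding position ([None] at
   the start), a sign, the flag of [valuation], and an index into
   [phi :: atoms phi]. *)
Definition astate : finType :=
  (option bool * bool * bool * 'I_(size (atoms phi)).+1)%type.

Definition astate_formula (q : astate) : formula P := nth phi (phi :: atoms phi) q.2.

Definition prev (q : astate) := q.1.1.1.
Definition sign (q : astate) := q.1.1.2.
Definition flag (q : astate) := q.1.2.

Definition enc (p : option bool) (b c : bool) x : astate :=
  (p, b, c, inord (index x (phi :: atoms phi))).

Definition succ_valuation (a : letter P) (X : {set astate}) : valuation P :=
  fun b c x => enc (Some (None \in a)) b c x \in X.

Definition existential (b : bool) f : bool :=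
  match f with
  | FDia _ _ | FDiaCp _ _ => b
  | FBox _ _ | FBoxCp _ _ => ~~ b
  | _ => false
  end.

(** The comparison with [prev q] also holds when [prev q] is [None], so position 0 is a
    changepoint. *)
Definition aut_delta (q : astate) (a : letter P) : posbool astate :=
  posbool_of (fun X => evs a (prev q != Some (None \in a)) (sign q)
                         (succ_valuation a X) (flag q) (astate_formula q)).

Definition automaton : aba (letter P) :=
  @ABA (letter P) astate (enc None true false phi) aut_delta
    [set q : astate | ~~ existential (sign q) (astate_formula q)].

Definition before w n : option bool :=
  if n is m.+1 then Some (None \in w m) else None.

Lemma changepoint_before w n :
  changepoint w n = (before w n != Some (None \in w n)).
Proof. by case: n. Qed.

Lemma existential_modal b bx cp r g :
  existential b (modal bx cp r g) = (b == ~~ bx).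
Proof. by case: bx cp b => [] [] []. Qed.

Lemma enc_formula p b c x : x \in phi :: atoms phi ->
  astate_formula (enc p b c x) = x.
Proof.
move=> xin; rewrite /astate_formula /enc inordK ?nth_index //.
by rewrite -index_mem in xin.
Qed.

Lemma astate_formula_in q : astate_formula q \in phi :: atoms phi.
Proof. by apply: mem_nth; exact: ltn_ord. Qed.

Lemma atoms_closed f x : f \in phi :: atoms phi -> x \in atoms f ->
  x \in phi :: atoms phi.
Proof.
rewrite !inE => /orP[/eqP->|fin] xin; first by rewrite xin orbT.
by rewrite (atoms_trans fin xin) orbT.
Qed.

Definition valid w n q : bool :=
  (prev q == before w n) && (truth w n (flag q) (astate_formula q) == sign q).

Lemma aut_deltaP w n q X : prev q = before w n ->
  posbool_sat X (aut_delta q (w n))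
  = evs (w n) (changepoint w n) (sign q) (succ_valuation (w n) X) (flag q)
      (astate_formula q).
Proof.
move=> pq; rewrite posbool_ofP ?pq ?changepoint_before // => {}X Y /subsetP sub.
by apply: evs_mono => e d x _; exact: sub.
Qed.

(** * Soundness: states on an accepting run make true claims *)

Section Soundness.
Variables (w : word (letter P)) (V : nat -> {set astate}).
Variable E : nat -> rel astate.
Hypothesis run : @is_run _ automaton w V E.
Hypothesis acc : @accepting _ automaton E.

Let succs n q := succ_valuation (w n) [set q' | E n q q'].

Lemma run_evs n q : q \in V n -> prev q = before w n ->
  evs (w n) (changepoint w n) (sign q) (succs n q) (flag q) (astate_formula q).
Proof.
by have [_ _ runV] := run; move=> /runV /= + pq; rewrite aut_deltaP.
Qed.

(** Induction on depth. A false universal claim is refuted within finitely many steps, and a false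
    existential claim would be postponed forever along a path without accepting states. *)
Lemma run_sound n q : q \in V n -> prev q = before w n -> valid w n q.
Proof.
have [_ runE _] := run.
have [d] := ubnP (depth (astate_formula q)).
elim: d => // d IH in n q *; rewrite ltnS => led qV pq.
have sub n' q' b c x : x \in atoms (astate_formula q') ->
    depth x < d -> succs n' q' b c x -> true_at w n'.+1 b c x.
  move=> xin ltd; rewrite /succs /succ_valuation inE => /runE[_ /IH].
  have xphi := atoms_closed (astate_formula_in q') xin.
  by rewrite /valid enc_formula // => /(_ ltd erefl)/andP[].
(* A witness against a universal state is passed on to a successor of the same kind, while [k],
   which bounds its distance, decreases. *)
have univ bx cp r g k n' q' : q' \in V n' -> prev q' = before w n' ->
    astate_formula q' = modal bx cp r g -> depth (modal bx cp r g) <= d ->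
    sign q' = bx -> forall m, m < n' + k -> ~ wit w n' (flag q') bx cp r g m.
  elim: k r n' q' => [|k IHk] r n' q' qV' pq' fq' led' sq' m ltm wm.
    by case: wm => /rmatch_le; rewrite leqNgt -(addn0 n') ltm.
  have := run_evs qV' pq'; rewrite fq' sq' -[evs _ _ _ _ _ _]negbK -evs_dual.
  apply/negP; rewrite negbK.
  apply: evs_wit wm => [e c x xin ltx tx|c r' xin wx].
    rewrite /dual; apply/negP => /sub.
    rewrite fq' /true_at (eqP tx) => /(_ xin (leq_trans ltx led')).
    by case: (e).
  rewrite /dual negbK /succs /succ_valuation inE; apply/negP => /runE[_ qV''].
  have fx : modal bx cp r' g \in phi :: atoms phi.
    by apply: atoms_closed (astate_formula_in q') _; rewrite fq'.
  have lex := leq_trans ((depth_atoms P).1 _ _ xin) led'.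
  apply: (IHk r' _ _ qV'' erefl (enc_formula _ _ _ fx) lex erefl m _ wx).
  by rewrite addSnnS.
have evalid q' n' : q' \in V n' -> prev q' = before w n' ->
    depth (astate_formula q') <= d ->
    (forall bx cp r c g, astate_formula q' = modal bx cp r g ->
       sign q' = ~~ bx -> forall r', modal bx cp r' g \in atoms (modal bx cp r g) ->
       succs n' q' (~~ bx) c (modal bx cp r' g) ->
       true_at w n'.+1 (~~ bx) c (modal bx cp r' g)) ->
    valid w n' q'.
  move=> qV' pq' led' subm; rewrite /valid pq' eqxx /= -evs_true.
  have := run_evs qV' pq'; have {}sub := sub n' q'.
  case: (modalP (astate_formula q')) => [[bx [cp [r [g e]]]]|nm]; last first.
    apply: evs_mono => b c x xin; apply: sub => //.
    have [lt|[bx [cp [r [r' [g [e _]]]]]]] := atomsP xin.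
      exact: leq_trans lt led'.
    by case: (nm _ _ _ _ e).
  rewrite e; have [eb|nb] := eqVneq (sign q') (~~ bx).
    rewrite eb; apply: evs_modal_mono => [b c x xin ltx|c r' xin].
      by rewrite e in led' sub; apply: sub => //; exact: leq_trans ltx led'.
    exact: (subm _ _ _ _ _ e eb).
  move=> _; have eb : sign q' = bx by case: (sign q') (bx) nb => [] [].
  rewrite evs_true truth_modal eb asboolF ?addbF // => -[m].
  rewrite e in led'; apply: (univ _ _ _ _ m.+1 _ _ qV' pq' e led' eb).
  by rewrite addnS ltnS leq_addl.
apply: contrapT => nvq.
pose bad n q := [/\ q \in V n, prev q = before w n, depth (astate_formula q) <= d,
  existential (sign q) (astate_formula q) & ~~ valid w n q].
(* By [evalid], an invalid state can only come from an invalid existential successor at which the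
   same modality is continued. *)
have next n' q' : q' \in V n' -> prev q' = before w n' ->
   depth (astate_formula q') <= d -> ~~ valid w n' q' ->
   exists q'', E n' q' q'' /\ bad n'.+1 q''.
  move=> qV' pq' led' nv; apply: contrapT => none; case/negP: nv.
  apply: evalid => // bx cp r c g e eb r' xin sx.
  apply: contrapT => nt; apply: none.
  have fx : modal bx cp r' g \in phi :: atoms phi.
    by apply: atoms_closed (astate_formula_in q') _; rewrite e.
  move: (sx); rewrite /succs /succ_valuation inE => qE.
  exists (enc (before w n'.+1) (~~ bx) c (modal bx cp r' g)).
  split=> //; split=> //; rewrite ?enc_formula ?existential_modal ?eqxx //.
  + by have [] := runE _ _ _ qE.
  + by rewrite (leq_trans _ led') // e (depth_atoms P).1.
  + by rewrite /valid enc_formula // eqxx; apply/negP.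
have [q1 [_ bad1]] := next n q qV pq led (introN idP nvq).
(* The default is never taken on bad states, because [next] provides a bad successor. *)
pose nxt k q' := odflt q' [pick q'' | E (n.+1 + k) q' q'' && `[< bad (n.+1 + k).+1 q'' >]].
pose rho := fix rho k := if k is k'.+1 then nxt k' (rho k') else q1.
have rhoP k : bad (n.+1 + k) (rho k) ->
    E (n.+1 + k) (rho k) (rho k.+1) /\ bad (n.+1 + k.+1) (rho k.+1).
  case=> qV' pq' led' _ nv; rewrite addnS /= /nxt.
  case: pickP => [q'' /andP[qE /asboolP]//|none].
  have [q'' [qE /asboolP bq]] := next _ _ qV' pq' led' nv.
  by have := none q''; rewrite qE bq.
have bad_rho k : bad (n.+1 + k) (rho k).
  by elim: k => [|k /rhoP[]//]; rewrite addn0.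
have [k _] := acc (fun k => (rhoP k (bad_rho k)).1) 0.
by rewrite inE; case: (bad_rho k) => _ _ _ ->.
Qed.

End Soundness.

(** * Completeness: an accepting run through all true claims *)

Section Completeness.
Variable w : word (letter P).

Lemma fwit_le n c f m : fwit w n c f m -> n <= m.
Proof.
case: (modalP f) => [[bx [cp [r [g ->]]]]|]; first by rewrite fwit_modal => -[/rmatch_le].
by case: f => // r g nm _; [have := nm false false r g | have := nm true false r g
  | have := nm false true r g | have := nm true true r g].
Qed.

Lemma existential_fwit n q :
  valid w n q -> existential (sign q) (astate_formula q) ->
  exists m, fwit w n (flag q) (astate_formula q) m.
Proof.
case/andP=> _ tq; case: (modalP (astate_formula q)) => [[bx [cp [r [g e]]]]|nm].
  rewrite e existential_modal => /eqP eb; rewrite e eb in tq.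
  by have /truth_wit[m wm] := tq; exists m; rewrite fwit_modal.
case: (astate_formula q) nm => // r g nm _; [have := nm false false r g
  | have := nm true false r g | have := nm false true r g
  | have := nm true true r g]; by [].
Qed.

(* Along an edge between existential states of equal depth, the end of the
   earliest match must not move away. *)
Definition good_edge n (q q' : astate) : bool :=
  let f := astate_formula q in let f' := astate_formula q' in
  (depth f' < depth f) ||
  [&& depth f' <= depth f, existential (sign q) f == existential (sign q') f'
    & existential (sign q) f ==>
      `[< forall m, fwit w n (flag q) f m ->
          exists2 m', m' <= m & fwit w n.+1 (flag q') f' m' >]].

Definition valid_edge n : rel astate :=
  fun q q' => [&& valid w n q, valid w n.+1 q' & good_edge n q q'].

(** After the last accepting state, the pair of the depth and the distance to a match end would
    decrease lexicographically forever. *)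
Lemma valid_edge_accepting : @accepting _ automaton valid_edge.
Proof.
move=> n rho edge k; apply: contrapT => none.
have ex i : k <= i -> existential (sign (rho i)) (astate_formula (rho i)).
  move=> ki; apply: contrapT => /negP ne; apply: none.
  by exists i => //; rewrite inE.
have dec d e i m : k <= i -> depth (astate_formula (rho i)) < d ->
    fwit w (n + i) (flag (rho i)) (astate_formula (rho i)) m ->
    m < n + i + e -> False.
  elim: d e i m => // d IHd; elim=> [|e IHe] i m ki ltd wm lt.
    by have := fwit_le wm; rewrite leqNgt -(addn0 (n + i)) lt.
  have /and3P[_ valid' /orP[ltd'|/and3P[led' _]]] := edge i.
    have ki' := leqW ki.
    have [m' wm'] := existential_fwit valid' (ex _ ki'); rewrite -addnS in wm'.
    (* When the depth drops, the modality may change, so the distance bound restarts from a new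
       witness. *)
    apply: (IHd m'.+1 i.+1 m') => //; first exact: leq_trans ltd' ltd.
    by rewrite addnS ltnS leq_addl.
  rewrite ex //= => /asboolP/(_ m wm)[m' lem' wm']; rewrite -addnS in wm'.
  apply: (IHe i.+1 m' (leqW ki)) => //; first exact: leq_ltn_trans led' ltd.
  by rewrite addnS addSnnS (leq_ltn_trans lem').
have /and3P[vk _ _] := edge k.
have [m wm] := existential_fwit vk (ex _ (leqnn k)).
apply: (dec _ m.+1 k m (leqnn k) (ltnSn _) wm).
by rewrite addnS ltnS leq_addl.
Qed.

(** The expansion holds under genuine truth; what remains is that good edges suffice. Edges that
    lower the depth are always good, and so are those between universal states. *)
Lemma valid_run : models w phi ->
  @is_run _ automaton w (fun n => [set q | valid w n q]) valid_edge.
Proof.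
move=> sphi; split=> [|n q q' /and3P[vq vq' _]|n q].
- by rewrite inE /valid enc_formula ?mem_head //= truth_sat asboolT.
- by rewrite !inE.
rewrite inE => vq; have /andP[/eqP pq tq] := vq.
rewrite /= aut_deltaP //; set S := succ_valuation _ _; set f := astate_formula q.
have SE b c x : x \in atoms f -> S b c x
    = true_at w n.+1 b c x
      && good_edge n q (enc (before w n.+1) b c x).
  move=> xin; rewrite /S /succ_valuation inE /valid_edge vq /= /valid eqxx.
  by rewrite enc_formula ?(atoms_closed (astate_formula_in q)).
have S_lt b c x : x \in atoms f -> depth x < depth f ->
    S b c x = true_at w n.+1 b c x.
  move=> xin lt; rewrite SE // /good_edge enc_formula ?lt ?andbT //.
  exact: (atoms_closed (astate_formula_in q)).
have tf : evs (w n) (changepoint w n) (sign q) (true_at w n.+1) (flag q) f.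
  by rewrite evs_true.
case: (modalP f) => [[bx [cp [r [g e]]]]|nm]; last first.
  apply: evs_mono tf => b c x xin; rewrite S_lt //.
  by have [|[? [? [? [? [? [/nm]]]]]]] := atomsP xin.
have inphi r' : modal bx cp r' g \in atoms f ->
    modal bx cp r' g \in phi :: atoms phi.
  exact: (atoms_closed (astate_formula_in q)).
rewrite e; have [eb|nb] := eqVneq (sign q) (~~ bx); last first.
  have eb : sign q = bx by case: (sign q) (bx) nb => [] [].
  rewrite -[evs _ _ _ _ _ _]negbK -evs_dual; apply/negP.
  rewrite eb => H; move: tf; rewrite e eb; apply/negP.
  rewrite -evs_dual dual_true; move: H; rewrite e in SE S_lt inphi.
  apply: evs_modal_mono => [b c x xin lt|c r' xin].
    by rewrite /dual S_lt // -/(dual (true_at w n.+1) b c x) dual_true.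
  have gd : good_edge n q (enc (before w n.+1) bx c (modal bx cp r' g)).
    rewrite /good_edge enc_formula ?inphi // -/f e !existential_modal eb.
    by rewrite (depth_atoms P).1 // !eqxx; case: (bx); rewrite orbT.
  rewrite /dual negbK SE // gd andbT.
  by rewrite /true_at; case: (bx); case: (truth _ _ _).
rewrite eb; have /truth_wit wex : truth w n (flag q) (modal bx cp r g) == ~~ bx.
  by rewrite -e -eb.
have {}wex : exists m, `[< wit w n (flag q) bx cp r g m >].
  by case: wex => m wm; exists m; apply/asboolP.
(* Following the earliest match end gives good edges: [m] stays a witness after the step and is at
   most every current one. *)
case: (ex_minnP wex) => m /asboolP wm minm.
rewrite e in SE S_lt inphi; apply: evs_wit wm => [b c x xin lt tx|c r' xin wx].
  by rewrite S_lt.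
rewrite SE // /true_at; apply/andP; split.
  by apply/truth_wit; exists m.
rewrite /good_edge enc_formula ?inphi // -/f e !existential_modal eb.
rewrite (depth_atoms P).1 // !eqxx /=; apply/orP; right; apply/asboolP => k.
rewrite fwit_modal => wk; exists m; last by rewrite fwit_modal.
by apply: minm; apply/asboolP.
Qed.

End Completeness.

(** * The recognized language and the number of states *)

Lemma automaton_language w : language automaton w <-> models w phi.
Proof.
split=> [[V [E [run acc]]]|sphi].
  have [init _ _] := run.
  have /andP[_] := run_sound run acc init erefl.
  by rewrite enc_formula ?mem_head //= truth_sat eqb_id => /asboolP.
exists (fun n => [set q | valid w n q]), (valid_edge w).
by split; [exact: valid_run|exact: valid_edge_accepting].
Qed.

Lemma card_automaton : #|state automaton| <= 12 * fsize phi.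
Proof.
(* The constant is 3 * 2 * 2, for the previous value of [p], the sign and the flag. The extra index
   for [phi] is paid for by its being one of its own subformulas. *)
rewrite !card_prod card_option card_bool card_ord leq_mul // /fsize -add1n.
apply: leq_add (size_atoms phi).
suff: phi \in undup (subformulas phi) by case: undup.
by rewrite mem_undup; case: (phi) => *; rewrite mem_head.
Qed.

End Automaton.

Theorem theorem2 :
  exists c : nat,
    forall (P : finType) (phi : formula P),
      exists A : aba (letter P),
        #|state A| <= c * fsize phi /\
        (forall w : word (letter P), language A w <-> models w phi).
Proof.
exists 12 => P phi; exists (automaton phi); split; first exact: card_automaton.
exact: automaton_language.
Qed.
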